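(* Let $x=(x_1,x_2,\ldots,x_n)\in S_{\ell_\infty^n}$. Then $x$ is $\rho$-left symmetric if and only if $x_j=0$ for all $j\in\{1,\ldots,n\}\setminus\mathcal{I}_x$.
   Context: $\ell_\infty^n$ is $\mathbb{R}^n$ with the norm $\|x\|=\max_i|x_i|$; $S_\mathbb{X}$ is the unit sphere of a normed space $\mathbb{X}$. For $x\in\mathbb{R}^n$, $\mathcal{I}_x=\{i\in\{1,\ldots,n\}:|x_i|=1\}$. Norm derivatives: $\rho'_{\pm}(x,y)=\|x\|\lim_{t\to 0^{\pm}}\frac{\|x+ty\|-\|x\|}{t}$ and $\rho'(x,y)=\frac12(\rho'_+(x,y)+\rho'_-(x,y))$. $\rho$-orthogonality: $x\perp_\rho y$ means $\rho'(x,y)=0$. An element $x\in\mathbb{X}$ is $\rho$-left symmetric if $x\perp_\rho y$ implies $y\perp_\rho x$ for all $y\in\mathbb{X}$. *)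

(* Defs.v *)
From HB Require Import structures.
From mathcomp Require Import all_boot all_order all_algebra.
From mathcomp Require Import all_classical all_reals all_analysis.

Set Implicit Arguments.
Unset Strict Implicit.
Unset Printing Implicit Defensive.

Import Order.TTheory GRing.Theory Num.Theory.
Import numFieldNormedType.Exports.

Local Open Scope classical_set_scope.
Local Open Scope ring_scope.

Section NormDerivatives.
Context {R : realType} {V : normedModType R}.
Implicit Types x y : V.

Definition unit_sphere : set V := [set x | `|x| = 1].

(* By convexity of t |-> `|x + t *: y|, the one-sided limits below always
   exist, so [lim] never takes its default value here. *)
Definition rho_plus x y : R :=
  `|x| * lim ((`|x + t *: y| - `|x|) / t @[t --> 0^'+]).

Definition rho_minus x y : R :=
  `|x| * lim ((`|x + t *: y| - `|x|) / t @[t --> 0^'-]).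

Definition rho x y : R := 2^-1 * (rho_plus x y + rho_minus x y).

Definition rho_orthogonal x y : Prop := rho x y = 0.

Definition rho_left_symmetric x : Prop :=
  forall y, rho_orthogonal x y -> rho_orthogonal y x.

End NormDerivatives.

Arguments unit_sphere {R} V.

(* The library norm on matrices is the maximum of the absolute values of the
   entries (mx_normrE), so row vectors are l_infty^n. *)
Notation linfty R n := 'rV[R]_n (only parsing).

Definition unimodular_indices {R : realType} {n : nat} (x : linfty R n) :
  {set 'I_n} := [set i | `|x 0 i| == 1]%SET.

(* Main.v *)
(** In [l_infty^n], for [v <> 0], the norm of [v + t y] equals
    [|v| + t max_i sgn(v_i) y_i] for all small [t > 0], the maximum being over
    the coordinates where [|v_i| = |v|]; hence [2 rho(v, y) / |v|] is the sum of
    the maximum and the minimum of [sgn(v_i) y_i] over these coordinates.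
    If [0 < |x_l| < 1], then [e_l] witnesses the failure of left symmetry.
    Conversely let [x] have entries in [{-1, 0, 1}] and [rho(x, y) = 0], [y <> 0].
    Either [y] attains its norm only where [x] vanishes, so [rho(y, x) = 0]
    trivially; or it attains it at some unimodular coordinate of [x], and then
    the opposite extrema of [sgn(x_i) y_i] must be [|y|] and [-|y|], so the
    extrema of [sgn(y_i) x_i] are [1] and [-1]. *)

Require Import Defs.
From mathcomp Require Import all_boot all_order all_algebra.
From mathcomp Require Import all_classical all_reals all_analysis.
From mathcomp Require Import lra.

Import Order.TTheory GRing.Theory Num.Theory.
Import numFieldNormedType.Exports.

Local Open Scope classical_set_scope.
Local Open Scope ring_scope.

Lemma linfty_norm_ge (R : realType) (n : nat) (v : 'rV[R]_n) (i : 'I_n) :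
  `|v 0 i| <= `|v|.
Proof.
rewrite [leRHS]/Num.norm /= mx_normrE.
exact: (le_bigmax _ (fun ij : 'I_1 * 'I_n => `|v ij.1 ij.2|) (0, i)).
Qed.

Lemma linfty_norm_le (R : realType) (n : nat) (v : 'rV[R]_n) (M : R) :
  0 <= M -> (forall i, `|v 0 i| <= M) -> `|v| <= M.
Proof.
move=> M0 vM; rewrite [leLHS]/Num.norm /= mx_normrE.
by apply: bigmax_le => // -[i j] _ /=; rewrite ord1.
Qed.

Lemma linfty_norm_attained (R : realType) (n : nat) (v : 'rV[R]_n) :
  v != 0 -> exists i, `|v 0 i| = `|v|.
Proof.
move=> v0; have /mx_norm_neq0[[i j] vij] : mx_norm v != 0.
  by move: v0; rewrite -normr_eq0.
by exists j; rewrite [RHS]/Num.norm /= vij /= ord1.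
Qed.

(** Every smallness condition on [t] in the norm expansion has this linear form with positive slack
    [b]. Adding 1 to |a| keeps the threshold b / (|a| + 1) meaningful when a = 0. *)
Lemma near_right0_mul_le (R : realType) (a b : R) :
  0 < b -> \forall t \near 0^'+, t * a <= b.
Proof.
move=> b0; have c0 : 0 < `|a| + 1 by rewrite ltr_wpDl.
near=> t.
have t0 : 0 < t by near: t; exact: nbhs_right_gt.
have : t < b / (`|a| + 1) by near: t; apply: nbhs_right_lt; rewrite divr_gt0.
rewrite ltr_pdivlMr// => /ltW; apply: le_trans.
by rewrite ler_pM2l// (le_trans (ler_norm a))// lerDl.
Unshelve. all: by end_near. Qed.

(** The quotient is constant for small t > 0: non-maximal coordinates are held back by their gap to
    the norm, and maximal ones move with slope sgn(v_k) y_k, largest at [i]. *)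
Lemma linfty_norm_right_derivative (R : realType) (n : nat) (v y : 'rV[R]_n)
    (i : 'I_n) :
  v != 0 -> `|v 0 i| = `|v| ->
  (forall k, `|v 0 k| = `|v| ->
    Num.sg (v 0 k) * y 0 k <= Num.sg (v 0 i) * y 0 i) ->
  (`|v + t *: y| - `|v|) / t @[t --> 0^'+] --> Num.sg (v 0 i) * y 0 i.
Proof.
set L := Num.sg (v 0 i) * y 0 i => v0 vi maxL.
have M0 : 0 < `|v| by rewrite normr_gt0.
apply: cvg_near_cst; near=> t.
have t0 : 0 < t by near: t; exact: nbhs_right_gt.
suff -> : `|v + t *: y| = `|v| + t * L.
  by rewrite addrAC subrr add0r mulrAC divff ?gt_eqF// mul1r.
have viE : `|v| + t * L = Num.sg (v 0 i) * (v 0 i + t * y 0 i).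
  by rewrite mulrDr -normrEsg vi mulrCA.
have sgi : `|Num.sg (v 0 i)| = 1 by rewrite normr_sg -normr_gt0 vi M0.
apply/eqP; rewrite eq_le; apply/andP; split; last first.
  have := linfty_norm_ge _ _ (v + t *: y) i; rewrite !mxE; apply: le_trans.
  by rewrite viE (le_trans (ler_norm _))// normrM sgi mul1r.
apply: linfty_norm_le => [|k].
  have : t * - L <= `|v| by near: t; exact: near_right0_mul_le.
  lra.
(* The admissible range of [t] depends on [k]; finiteness of the index set gives a common one. *)
rewrite !mxE; move: k; near: t; apply: filter_forall => k.
have [vk|vk] := eqVneq `|v 0 k| `|v|.
  near=> t.
  have t0 : 0 < t by near: t; exact: nbhs_right_gt.
  have sk : Num.sg (v 0 k) * Num.sg (v 0 k) = 1.
    by rewrite -expr2 sqr_sg -normr_gt0 vk M0.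
  have sgk : `|Num.sg (v 0 k)| = 1 by rewrite normr_sg -normr_gt0 vk M0.
  (* Multiplying by the sign of v_k turns v_k + t y_k into |v| + t sgn(v_k) y_k, which is
     nonnegative for small t. *)
  rewrite -[leLHS]mul1r -{1}sgk -normrM mulrDr -normrEsg vk mulrCA.
  rewrite ger0_norm; first by rewrite lerD2l ler_pM2l// maxL.
  have : t * - (Num.sg (v 0 k) * y 0 k) <= `|v|.
    by near: t; exact: near_right0_mul_le.
  lra.
have {}vk : 0 < `|v| - `|v 0 k|.
  by rewrite subr_gt0 lt_neqAle vk linfty_norm_ge.
near=> t.
have t0 : 0 < t by near: t; exact: nbhs_right_gt.
have : t * (`|y 0 k| - L) <= `|v| - `|v 0 k|.
  by near: t; exact: near_right0_mul_le.
have := ler_normD (v 0 k) (t * y 0 k); rewrite normrM (gtr0_norm t0).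
lra.
Unshelve. all: by end_near. Qed.

Lemma linfty_rho (R : realType) (n : nat) (v y : 'rV[R]_n) :
  v != 0 ->
  exists i j, [/\ `|v 0 i| = `|v|, `|v 0 j| = `|v|,
    forall k, `|v 0 k| = `|v| ->
      Num.sg (v 0 j) * y 0 j <= Num.sg (v 0 k) * y 0 k <=
      Num.sg (v 0 i) * y 0 i &
    rho v y = 2^-1 *
      (`|v| * (Num.sg (v 0 i) * y 0 i + Num.sg (v 0 j) * y 0 j))].
Proof.
move=> v0; have [k0 vk0] := linfty_norm_attained _ _ v v0.
pose P k := `|v 0 k| == `|v|; pose F k := Num.sg (v 0 k) * y 0 k.
have Pk0 : P k0 by rewrite /P vk0.
case: (@arg_maxP _ _ _ k0 P F Pk0) => i /eqP vi maxi.
case: (@arg_minP _ _ _ k0 P F Pk0) => j /eqP vj minj.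
exists i, j; split => // [k /eqP vk|].
  by apply/andP; split; [exact: minj|exact: maxi].
have Dplus := linfty_norm_right_derivative _ _ v y i v0 vi
  (fun k vk => maxi k (introT eqP vk)).
have Dminus : (`|v + t *: y| - `|v|) / t @[t --> 0^'-] --> F j.
  (* The left derivative along y is minus the right derivative along -y, so the maximum turns into a
     minimum. *)
  apply/cvg_at_leftNP; rewrite oppr0 -[F j]opprK.
  have -> : (fun t => (`|v + t *: y| - `|v|) / t) \o -%R =
      (fun t => - ((`|v + t *: - y| - `|v|) / t)).
    by apply/funext => t /=; rewrite scaleNr scalerN invrN mulrN.
  apply: cvgN.
  have -> : - F j = Num.sg (v 0 j) * (- y) 0 j by rewrite mxE mulrN.
  apply: linfty_norm_right_derivative => // k /eqP vk.
  by rewrite !mxE !mulrN lerN2; exact: minj.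
by rewrite /rho /rho_plus /rho_minus (cvg_lim _ Dplus)// (cvg_lim _ Dminus)//
  -mulrDr.
Qed.

Lemma rho0l (R : realType) (V : normedModType R) (y : V) : rho 0 y = 0.
Proof. by rewrite /rho /rho_plus /rho_minus normr0 !mul0r addr0 mulr0. Qed.

Lemma linfty_rho_orthogonal (R : realType) (n : nat) (v y : 'rV[R]_n) :
  v != 0 ->
  exists i j, [/\ `|v 0 i| = `|v|, `|v 0 j| = `|v|,
    forall k, `|v 0 k| = `|v| ->
      Num.sg (v 0 j) * y 0 j <= Num.sg (v 0 k) * y 0 k <=
      Num.sg (v 0 i) * y 0 i &
    rho_orthogonal v y <->
      Num.sg (v 0 i) * y 0 i + Num.sg (v 0 j) * y 0 j = 0].
Proof.
move=> v0; have [i [j [vi vj vk rhoE]]] := linfty_rho _ _ v y v0.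
exists i, j; split=> //; rewrite /rho_orthogonal rhoE.
split=> [/eqP|->]; last by rewrite !mulr0.
by rewrite !mulf_eq0 invr_eq0 pnatr_eq0 normr_eq0 (negbTE v0) => /eqP.
Qed.

Lemma sgr_norm1 (R : realType) (a : R) : `|a| = 1 -> Num.sg a = a.
Proof. by move=> a1; rewrite [RHS]numEsg a1 mulr1. Qed.

Theorem theorem3p16 (R : realType) (n : nat) (x : linfty R n)
    (hx : unit_sphere (linfty R n) x) :
  rho_left_symmetric x <->
  (forall j : 'I_n, j \notin unimodular_indices x -> x 0 j = 0).
Proof.
have x1 : `|x| = 1 by exact: hx.
have x0 : x != 0 by rewrite -normr_gt0 x1 ltr01.
split=> [symx l xl|x_off y].
  pose e : 'rV[R]_n := delta_mx 0 l.
  have xl1 : `|x 0 l| != 1 by move: xl; rewrite inE.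
  have eE k : e 0 k = (k == l)%:R by rewrite mxE eqxx.
  have e0 : e != 0.
    by apply/eqP => /matrixP/(_ 0 l); rewrite eE mxE eqxx => /eqP; rewrite oner_eq0.
  have e1 : `|e| = 1.
    have [k] := linfty_norm_attained _ _ e e0; rewrite eE => ek.
    move: e0; rewrite -normr_eq0 -ek.
    by case: (k == l); rewrite ?normr1// normr0 eqxx.
  have el k : `|e 0 k| = `|e| -> k = l.
    rewrite e1 eE; case: eqVneq => // _; rewrite normr0 => /esym/eqP.
    by rewrite oner_eq0.
  have [i [j [xi xj _ [_ xe]]]] := linfty_rho_orthogonal _ _ x e x0.
  have [p [q [/el -> /el -> _ [ex _]]]] := linfty_rho_orthogonal _ _ e x e0.
  have ne k : `|x 0 k| = `|x| -> e 0 k = 0.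
    by rewrite x1 eE; case: eqVneq => // -> /eqP; rewrite (negbTE xl1).
  have /xe/symx/ex : Num.sg (x 0 i) * e 0 i + Num.sg (x 0 j) * e 0 j = 0.
    by rewrite !ne// !mulr0 addr0.
  (* The norm of [e] is attained only at [l], so both extrema equal x_l and orthogonality reads x_l
     + x_l = 0. *)
  by rewrite eE eqxx sgr1 mul1r; lra.
have [->|y0] := eqVneq y 0; first by move=> _; exact: rho0l.
have M0 : 0 < `|y| by rewrite normr_gt0.
have [i [j [xi xj xk [xy _]]]] := linfty_rho_orthogonal _ _ x y x0.
have [p [q [yp yq yk [_ yx]]]] := linfty_rho_orthogonal _ _ y x y0.
move=> /xy; rewrite x1 in xi xj xk => xyij; apply: yx.
have [[k]|] := pselect (exists k, `|x 0 k| = 1 /\ `|y 0 k| = `|y|); last first.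
  move=> disj.
  have off k : `|y 0 k| = `|y| -> x 0 k = 0.
    move=> yk'; apply: x_off; rewrite inE; apply/eqP => xk'.
    by apply: disj; exists k.
  by rewrite !off// !mulr0 addr0.
move=> [xk1 ykM].
have bounds l : `|x 0 l| = 1 -> `|Num.sg (x 0 l) * y 0 l| <= `|y|.
  by move=> xl; rewrite normrM sgr_norm1// xl mul1r linfty_norm_ge.
have skM : `|Num.sg (x 0 k) * y 0 k| = `|y|.
  by rewrite normrM sgr_norm1// xk1 mul1r.
have /andP[] := xk k xk1.
move: (bounds i xi) (bounds j xj); rewrite !ler_norml => /andP[? ?] /andP[? ?].
move=> ? ?.
(* The extrema are opposite, lie in [-|y|, |y|] and enclose the value at [k], which is |y| or
   -|y|. *)
have [aM bM] : Num.sg (x 0 i) * y 0 i = `|y| /\ Num.sg (x 0 j) * y 0 j = - `|y|.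
  by case: (ler0P (Num.sg (x 0 k) * y 0 k)) skM => ? skM; split; lra.
(* Since x_l^2 = 1, y_l = x_l s |y|; hence sgn(y_l) = x_l s, and multiplying by x_l leaves s. *)
have flip l s : `|x 0 l| = 1 -> `|s| = 1 -> Num.sg (x 0 l) * y 0 l = s * `|y| ->
    `|y 0 l| = `|y| /\ Num.sg (y 0 l) * x 0 l = s.
  move=> xl s1; rewrite sgr_norm1// => xyl.
  have yl : y 0 l = (x 0 l * s) * `|y|.
    by rewrite -mulrA -xyl mulrA -expr2 -real_normK ?num_real// xl expr1n mul1r.
  rewrite yl !normrM normr_id xl s1 !mul1r sgrM (gtr0_sg M0) mulr1; split=> //.
  rewrite sgr_norm1 ?normrM ?xl ?s1 ?mulr1// mulrAC -expr2.
  by rewrite -real_normK ?num_real// xl expr1n mul1r.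
have [yi si] : `|y 0 i| = `|y| /\ Num.sg (y 0 i) * x 0 i = 1.
  by apply: flip => //; rewrite ?normr1// mul1r.
have [yj sj] : `|y 0 j| = `|y| /\ Num.sg (y 0 j) * x 0 j = -1.
  by apply: flip => //; rewrite ?normrN1// mulN1r.
(* With this bound, the values 1 at [i] and -1 at [j] are extreme, so those at [p] and [q] are 1 and
   -1. *)
have le1 l : `|Num.sg (y 0 l) * x 0 l| <= 1.
  rewrite normrM normr_sg -[leRHS]mul1r; apply: ler_pM => //.
    by case: (_ != 0); rewrite ?ler01.
  by rewrite -x1 linfty_norm_ge.
have := yk i yi; have := yk j yj; rewrite si sj => /andP[? ?] /andP[? ?].
have := le1 p; have := le1 q; rewrite !ler_norml => /andP[? ?] /andP[? ?].
lra.
Qed.
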